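(* Let $1\le t\le f\le n$, let $T$ be an intersection type of size $t$, let $\mathcal{F}^f_T$ be the (finite) set of $T$-flags of size $f$ (up to label-preserving isomorphism) that do not contain $A$ as an induced subgraph, and fix an injective map $\Theta:[t]\to[n]$. Let $\mathbf{d}^{\Theta,T,f}:=(\mathsf{d}^\Theta_F)_{F\in\mathcal{F}^f_T}$, let $Q\in\mathbb{R}^{|\mathcal{F}^f_T|\times|\mathcal{F}^f_T|}$ be positive semidefinite, and let $\mathsf{r}_1,\mathsf{r}_2,\dots$ be the components of the vector $Q^{1/2}\mathbf{d}^{\Theta,T,f}$, so that ${\mathbf{d}^{\Theta,T,f}}^\top Q\,\mathbf{d}^{\Theta,T,f}=\sum_k\mathsf{r}_k^2$. Let $\boldsymbol{\lambda}=(n-t,1^t)$ and let $\tau_{\boldsymbol{\lambda}}$ be a tableau of shape $\boldsymbol{\lambda}$ whose first row is filled with the elements of $[n]\setminus\{\Theta(i):i\in[t]\}$ and whose remaining $t$ rows of length one are filled with the elements of $\{\Theta(i):i\in[t]\}$ (in any order). Then each $\mathsf{r}_k$ is invariant under the row group $\mathfrak{R}_{\tau_{\boldsymbol{\lambda}}}$.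
   Context: $A$ is a fixed graph (the forbidden induced subgraph). $\mathbb{R}[\mathbf{x}]$ denotes the polynomial ring in the variables $\mathsf{x}_{ij}$, $1\le i<j\le n$ (with $\mathsf{x}_{ji}:=\mathsf{x}_{ij}$), on which $\mathfrak{S}_n$ acts by $\mathfrak{s}\,\mathsf{x}_{ij}:=\mathsf{x}_{\mathfrak{s}(i)\mathfrak{s}(j)}$, extended multiplicatively to monomials and linearly. An intersection type of size $t$ is a graph $T$ on $t$ vertices labeled by distinct elements of $[t]$. A $T$-flag of size $f$ is a graph $F$ on $f$ vertices in which $t$ vertices carry the distinct labels $1,\dots,t$ and induce a copy of $T$ with identical labels. For injective $h:V(F)\to[n]$, $\mathsf{p}^h_F:=\prod_{\{u,v\}\in E(F)}\mathsf{x}_{h(u)h(v)}\prod_{\{u,v\}\in\binom{V(F)}{2}\setminus E(F)}(1-\mathsf{x}_{h(u)h(v)})$. For injective $\Theta:[t]\to[n]$, $\mathrm{Inj}_\Theta(V(F),[n])$ is the set of injective $h:V(F)\to[n]$ with $h(v)=\Theta(i)$ whenever $v$ is labeled $i$, and $\mathsf{d}^\Theta_F:=\frac{1}{|\mathrm{Inj}_\Theta(V(F),[n])|}\sum_{h\in\mathrm{Inj}_\Theta(V(F),[n])}\mathsf{p}^h_F$. A tableau of shape $\boldsymbol{\lambda}=(\lambda_1\ge\dots\ge\lambda_k)$ (a partition of $n$) is a filling of the Young diagram with rows of lengths $\lambda_1,\dots,\lambda_k$ by $1,\dots,n$, each once; $(n-t,1^t)$ is the hook partition with parts $n-t,1,\dots,1$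 ($t$ ones). The row group $\mathfrak{R}_{\tau}$ of a tableau $\tau$ is the subgroup of $\mathfrak{S}_n$ of permutations preserving the set of entries of each row. *)

(* Defs.v *)
From mathcomp Require Import all_boot all_order all_algebra all_fingroup.
From mathcomp Require Import reals.
From mathcomp Require Import mpoly.

Set Implicit Arguments.
Unset Strict Implicit.
Unset Printing Implicit Defensive.

Import GRing.Theory Num.Theory.
Local Open Scope ring_scope.

(** * Graphs and flags *)

Definition pairs (V : finType) : {set {set V}} := [set e : {set V} | #|e| == 2%N].

Definition graph (V : finType) := {E : {set {set V}} | E \subset pairs V}.

Definition edges (V : finType) (G : graph V) : {set {set V}} := val G.

Definition adj (V : finType) (G : graph V) : rel V :=
  fun u v => [set u; v] \in edges G.

Definition contains_induced (VA V : finType) (A : graph VA) (G : graph V) : bool :=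
  [exists h : {ffun VA -> V},
     injectiveb h && [forall u, forall v, adj G (h u) (h v) == adj A u v]].

(* The label i is carried by the vertex F.2 i. *)
Definition is_flag (t f : nat) (T : graph 'I_t)
    (F : graph 'I_f * {ffun 'I_t -> 'I_f}) : bool :=
  injectiveb F.2
    && [forall i, forall j, adj F.1 (F.2 i) (F.2 j) == adj T i j].

Definition flag (t f : nat) (T : graph 'I_t) : Type :=
  {F : graph 'I_f * {ffun 'I_t -> 'I_f} | is_flag T F}.

Definition flag_graph (t f : nat) (T : graph 'I_t) (F : flag f T) : graph 'I_f :=
  (val F).1.

Definition flag_label (t f : nat) (T : graph 'I_t) (F : flag f T) :
  {ffun 'I_t -> 'I_f} := (val F).2.

Definition flag_iso (t f : nat) (T : graph 'I_t) : rel (flag f T) :=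
  fun F1 F2 =>
    [exists s : 'S_f,
       [forall i, s (flag_label F1 i) == flag_label F2 i] &&
       [forall u, forall v,
          adj (flag_graph F2) (s u) (s v) == adj (flag_graph F1) u v]].

Definition free_flags (VA : finType) (A : graph VA) (t f : nat) (T : graph 'I_t) :
  {set flag f T} := [set F | ~~ contains_induced A (flag_graph F)].

(* One representative of each isomorphism class of A-free T-flags. *)
Definition flags (VA : finType) (A : graph VA) (t f : nat) (T : graph 'I_t) :
  {set flag f T} :=
  let D := free_flags A f T in
  transversal (equivalence_partition (@flag_iso t f T) D) D.

Lemma flag_iso_equiv (t f : nat) (T : graph 'I_t) :
  equivalence_rel (@flag_iso t f T).
Proof.
apply/equivalence_relP; split=> [F | F1 F2 /existsP[s /andP[/forallP sl /forallP sa]]].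
  apply/existsP; exists 1%g; apply/andP; split.
    by apply/forallP=> i; rewrite perm1.
  by apply/forallP=> u; apply/forallP=> v; rewrite !perm1.
move=> F3; apply/existsP/existsP=> [[r] | [r]] /andP[/forallP rl /forallP ra].
  exists (s^-1 * r)%g; apply/andP; split.
    by apply/forallP=> i; rewrite permM -(eqP (sl i)) permK.
  apply/forallP=> u; apply/forallP=> v; rewrite !permM.
  have /eqP-> := forallP (ra (s^-1 u)%g) (s^-1 v)%g.
  by have /eqP := forallP (sa (s^-1 u)%g) (s^-1 v)%g; rewrite !permKV => ->.
exists (s * r)%g; apply/andP; split.
  by apply/forallP=> i; rewrite permM (eqP (sl i)).
apply/forallP=> u; apply/forallP=> v; rewrite !permM.
have /eqP-> := forallP (ra (s u)) (s v).
exact: (forallP (sa u) v).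
Qed.

Lemma flags_transversal (VA : finType) (A : graph VA) (t f : nat) (T : graph 'I_t) :
  is_transversal (flags A f T)
    (equivalence_partition (@flag_iso t f T) (free_flags A f T))
    (free_flags A f T).
Proof.
apply: transversalP; apply: equivalence_partitionP => F1 F2 F3 _ _ _.
exact: flag_iso_equiv.
Qed.

(** * The polynomial ring on the edge variables of the complete graph on [n] *)

(* Indexing the variables by two-element sets {i, j} instead of pairs i < j
   builds in the convention x_ji = x_ij. *)
Notation edge n := {e : {set 'I_n} | #|e| == 2%N}.

Notation epoly R n := {mpoly R[#|{: edge n}|]}.

(* The value 0 is a dummy, taken only on sets that do not have two elements. *)
Definition xvar (R : realType) (n : nat) (e : {set 'I_n}) : epoly R n :=
  if insub e is Some e' then 'X_(enum_rank (e' : edge n)) else 0.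

Definition sym_act (R : realType) (n : nat) (s : 'S_n) (p : epoly R n) : epoly R n :=
  p \mPo [tuple xvar R (s @: val (enum_val k)) | k < #|{: edge n}|].

Definition pF (R : realType) (n f : nat) (F : graph 'I_f) (h : 'I_f -> 'I_n) :
  epoly R n :=
  (\prod_(e in edges F) xvar R (h @: e)) *
  (\prod_(e in pairs 'I_f :\: edges F) (1 - xvar R (h @: e))).

Definition Inj (n t f : nat) (T : graph 'I_t) (Theta : 'I_t -> 'I_n)
    (F : flag f T) : {set {ffun 'I_f -> 'I_n}} :=
  [set h : {ffun 'I_f -> 'I_n} |
     injectiveb h && [forall i, h (flag_label F i) == Theta i]].

Definition dF (R : realType) (n t f : nat) (T : graph 'I_t) (Theta : 'I_t -> 'I_n)
    (F : flag f T) : epoly R n :=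
  (#|Inj Theta F|%:R^-1 : R) *: \sum_(h in Inj Theta F) pF R (flag_graph F) h.

Definition dvec (R : realType) (VA : finType) (A : graph VA) (n t f : nat)
    (T : graph 'I_t) (Theta : 'I_t -> 'I_n) : 'cV[epoly R n]_#|flags A f T| :=
  \col_k dF R Theta (enum_val k).

Definition const_poly_mx (R : realType) (n p q : nat) (M : 'M[R]_(p, q)) :
  'M[epoly R n]_(p, q) := \matrix_(i, j) (M i j)%:MP.

(** * Positive semidefinite matrices *)

Definition psd (R : realType) (m : nat) (Q : 'M[R]_m) : Prop :=
  Q^T = Q /\ forall v : 'cV[R]_m, 0 <= (v^T *m Q *m v) 0 0.

(* S = Q^{1/2}: the principal square root. *)
Definition is_psd_sqrt (R : realType) (m : nat) (Q S : 'M[R]_m) : Prop :=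
  psd S /\ S *m S = Q.

(** * Tableaux *)

(* When t = n the first row is empty, and the Young diagram is that of (1^n). *)
Definition hook (n t : nat) : seq nat := (n - t)%N :: nseq t 1%N.

Definition is_tableau (n : nat) (lambda : seq nat) (tau : seq (seq 'I_n)) : Prop :=
  shape tau = lambda /\ perm_eq (flatten tau) (enum 'I_n).

Definition row_group_set (n : nat) (tau : seq (seq 'I_n)) : {set 'S_n} :=
  [set s : 'S_n | all (fun r => s @: [set x in r] == [set x in r]) tau].

Lemma row_group_set_group (n : nat) (tau : seq (seq 'I_n)) :
  group_set (row_group_set tau).
Proof.
apply/group_setP; split=> [|s r]; rewrite !inE.
  apply/allP=> l _; apply/eqP/setP=> x; apply/imsetP/idP=> [[y yl ->] | xl].
    by rewrite perm1.
  by exists x; rewrite ?perm1.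
move=> /allP hs /allP hr; apply/allP=> l lt.
have -> : (s * r)%g @: [set x in l] = r @: (s @: [set x in l]).
  by rewrite -imset_comp; apply: eq_imset => x; rewrite permM.
by rewrite (eqP (hs l lt)) (eqP (hr l lt)).
Qed.

Canonical row_group (n : nat) (tau : seq (seq 'I_n)) : {group 'S_n} :=
  Group (row_group_set_group tau).

(* Main.v *)
(** The rows of [tau] below the first are the singletons [{Theta i}], so the row
    group fixes every [Theta i]. Composing an embedding [h] with such a
    permutation [s] therefore permutes the set over which [dF] averages, while
    [s] sends [pF h] to [pF (s \o h)]: each [dF] is invariant, and so is every
    real linear combination of them. *)

Require Import Defs.
From mathcomp Require Import all_boot all_order all_algebra all_fingroup.
From mathcomp Require Import reals.
From mathcomp Require Import mpoly.

Set Implicit Arguments.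
Unset Strict Implicit.
Unset Printing Implicit Defensive.

Import GRing.Theory Num.Theory.
Local Open Scope ring_scope.

Section SymAct.
Variables (R : realType) (n : nat) (s : 'S_n).

(** The dummy value causes no exception: [s] preserves cardinality, so a set without two elements
    goes to another such set and both sides are 0. *)
Lemma sym_act_xvar e : sym_act s (xvar R e) = xvar R (s @: e).
Proof.
have card_se : #|s @: e| = #|e| by apply: card_imset; apply: perm_inj.
rewrite {1}/xvar; case: insubP => [e' _ <-|e_n2].
  by rewrite /sym_act comp_mpolyXU -tnth_nth tnth_mktuple enum_rankK.
by rewrite /sym_act comp_mpoly0 /xvar insubN // card_se.
Qed.

(** Both products range over pairs of vertices of [F], whatever [h] is, so the substitution, being a
    ring morphism, acts factor by factor. *)
Lemma sym_act_pF f (F : graph 'I_f) (h : 'I_f -> 'I_n) :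
  sym_act s (pF R F h) = pF R F (s \o h).
Proof.
rewrite /pF /sym_act rmorphM !rmorph_prod; congr (_ * _); apply: eq_bigr => e _.
  by rewrite [LHS]sym_act_xvar -imset_comp.
by rewrite rmorphB rmorph1 [X in 1 - X]sym_act_xvar -imset_comp.
Qed.

Lemma sym_act_dF t f (T : graph 'I_t) (Theta : 'I_t -> 'I_n) (F : flag f T) :
  (forall i, s (Theta i) = Theta i) -> sym_act s (dF R Theta F) = dF R Theta F.
Proof.
move=> sTheta; rewrite /dF /sym_act linearZ rmorph_sum /=; congr (_ *: _).
pose comp (r : 'S_n) (h : {ffun 'I_f -> 'I_n}) := [ffun x => r (h x)].
have compK : cancel (comp s) (comp s^-1%g).
  by move=> h; apply/ffunP=> x; rewrite !ffunE permK.
have compVK : cancel (comp s^-1%g) (comp s).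
  by move=> h; apply/ffunP=> x; rewrite !ffunE permKV.
rewrite [RHS](reindex (comp s)) /=; last by exists (comp s^-1%g) => h _.
apply: eq_big => h => [|_].
  rewrite !inE; congr (_ && _).
    apply/injectiveP/injectiveP => inj_h x y; last first.
      by move=> hxy; apply: inj_h; rewrite !ffunE hxy.
    by rewrite !ffunE => /perm_inj/inj_h.
  apply: eq_forallb => i.
  (* Writing [Theta i] as [s (Theta i)] lets injectivity cancel [s] from the label condition. *)
  by rewrite ffunE -[in RHS](sTheta i) (inj_eq perm_inj).
(* [comp s h] agrees with [s \o h] only pointwise, hence the comparison of images of pairs. *)
rewrite [LHS]sym_act_pF; rewrite /pF; congr (_ * _); apply: eq_bigr => e _.
  by congr (xvar R _); apply: eq_imset => x; rewrite ffunE.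
by congr (1 - xvar R _); apply: eq_imset => x; rewrite ffunE.
Qed.

End SymAct.

Lemma const_poly_mxM (R : realType) n p q r (M : 'M[R]_(p, q)) (N : 'M[R]_(q, r)) :
  const_poly_mx n (M *m N) = const_poly_mx n M *m const_poly_mx n N.
Proof.
apply/matrixP=> i j; rewrite !mxE rmorph_sum /=.
by apply: eq_bigr => k _; rewrite !mxE rmorphM.
Qed.

Lemma const_poly_mx_tr (R : realType) n p q (M : 'M[R]_(p, q)) :
  const_poly_mx n M^T = (const_poly_mx n M)^T.
Proof. by apply/matrixP=> i j; rewrite !mxE. Qed.

(** The hook shape makes every row below the first a singleton, and preserving a singleton as a set
    means fixing its entry. *)
Lemma row_group_hook_fix n t (tau : seq (seq 'I_n)) (s : 'S_n) x :
  shape tau = hook n t -> s \in row_group tau ->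
  x \in flatten (behead tau) -> s x = x.
Proof.
case: tau => [|r0 tau] //= [_ sh_tau]; rewrite inE /= => /andP[_ /allP s_tau].
case/flattenP=> row row_tau.
have: size row \in nseq t 1%N by rewrite -sh_tau map_f.
case/nseqP=> size_row _; move: (s_tau _ row_tau).
case: row size_row {row_tau} => [|y []] //= _.
move=> /eqP s_y; rewrite inE => /eqP->.
have: s y \in s @: [set z in [:: y]] by apply: imset_f; rewrite !inE.
by rewrite s_y !inE => /eqP.
Qed.

Theorem theorem4p3 (R : realType) (VA : finType) (A : graph VA) (n t f : nat)
    (ht : (1 <= t)%N) (htf : (t <= f)%N) (hfn : (f <= n)%N)
    (T : graph 'I_t) (Theta : 'I_t -> 'I_n) (hTheta : injective Theta)
    (Q : 'M[R]_#|flags A f T|) (hQ : psd Q)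
    (Qhalf : 'M[R]_#|flags A f T|) (hQhalf : is_psd_sqrt Q Qhalf)
    (tau : seq (seq 'I_n)) (htau : is_tableau (hook n t) tau)
    (hfirst : [set x in head [::] tau] = ~: [set Theta i | i : 'I_t])
    (hrest : [set x in flatten (behead tau)] = [set Theta i | i : 'I_t]) :
  let d := dvec R A f T Theta in
  let r := const_poly_mx n Qhalf *m d in
  (d^T *m const_poly_mx n Q *m d) 0 0 = \sum_k (r k 0) ^+ 2 /\
  forall k s, s \in row_group tau -> sym_act s (r k 0) = r k 0.
Proof.
move=> d r; split.
  (* Symmetry of the square root gives [Q = Qhalf^T *m Qhalf], so the quadratic form is
     [r^T *m r]. *)
  have [[Qhalf_tr _] <-] := hQhalf.
  have -> : d^T *m const_poly_mx n (Qhalf *m Qhalf) *m d = r^T *m r.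
    by rewrite const_poly_mxM trmx_mul -const_poly_mx_tr Qhalf_tr !mulmxA.
  by rewrite mxE; apply: eq_bigr => k _; rewrite mxE expr2.
move=> k s s_tau.
have sTheta i : s (Theta i) = Theta i.
  apply: (row_group_hook_fix htau.1 s_tau).
  have: Theta i \in [set x in flatten (behead tau)] by rewrite hrest imset_f.
  by rewrite inE.
(* The coefficients from [Qhalf] are constant polynomials, which substitution leaves unchanged. *)
rewrite mxE /sym_act rmorph_sum; apply: eq_bigr => j _; rewrite rmorphM !mxE.
by congr (_ * _); [apply: comp_mpolyC | apply: sym_act_dF].
Qed.
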